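(* Let $n\ge0$ and let $w_1,w_2\in\mathbb{N}$ with $w_1\equiv1\pmod 2$ and $w_2\equiv1\pmod2$. Then, for all $x$ (as an identity of polynomials in $x$), \[ \sum_{l=0}^{n}(-4)^{n-l}C_{l,w_1}(w_2x)\,S_{n-l,w_2}(w_1-1)=\sum_{l=0}^{n}(-4)^{n-l}C_{l,w_2}(w_1x)\,S_{n-l,w_1}(w_2-1). \]
   Context: For $w\in\mathbb{N}$, the $w$-Catalan polynomials $C_{n,w}(x)$ are defined by the generating function \[ \frac{2}{1+(1-4t)^{w/2}}(1-4t)^{\frac{w}{2}x}=\sum_{n\ge0}C_{n,w}(x)t^n, \] where $(1-4t)^{a}=\sum_{k\ge0}\binom{a}{k}(-4t)^k$ and $\binom{a}{k}=\frac{a(a-1)\cdots(a-k+1)}{k!}$. For integers $k\ge0$ and $d,w\in\mathbb{N}$ odd, define \[ S_{k,d}(w-1)=\sum_{i=0}^{w-1}\binom{\frac{di}{2}}{k}(-1)^i. \] *)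

(* Defs.v *)
From mathcomp Require Import all_boot all_order all_algebra.

Set Implicit Arguments.
Unset Strict Implicit.
Unset Printing Implicit Defensive.

Import GRing.Theory.
Local Open Scope ring_scope.

Section FormalPowerSeries.
Variable R : comUnitRingType.

(* A formal power series is its coefficient sequence: f stands for            *)
(* \sum_n (f n) t^n.                                                          *)
Definition fps := nat -> R.

Implicit Types (f g : fps) (a c : R) (n k : nat).

Definition fps_const c : fps := fun n => if n == 0%N then c else 0.

Definition fps_add f g : fps := fun n => f n + g n.

Definition fps_mul f g : fps := fun n => \sum_(i < n.+1) f i * g (n - i)%N.

(* The coefficients 0, ..., n of 1 / f, computed from left to right. *)
Fixpoint fps_inv_seq f n : seq R :=
  if n is m.+1 then
    let s := fps_inv_seq f m in
    rcons s (- (f 0%N)^-1 * \sum_(i < n) f (n - i)%N * s`_i)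
  else [:: (f 0%N)^-1].

(* Meaningful when f 0 is a unit, see fps_mulfV. *)
Definition fps_inv f : fps := fun n => (fps_inv_seq f n)`_n.

Definition fps_div f g : fps := fps_mul f (fps_inv g).

(* a (a - 1) ... (a - k + 1) / k!, meaningful when k! is a unit of R. *)
Definition gbinom a k : R := (\prod_(i < k) (a - i%:R)) / (k`!)%:R.

(* (1 - 4t)^a *)
Definition pow_1m4t a : fps := fun k => gbinom a k * (- 4%:R) ^+ k.

Lemma size_fps_inv_seq f n : size (fps_inv_seq f n) = n.+1.
Proof. by elim: n => //= n IHn; rewrite size_rcons IHn. Qed.

Lemma nth_fps_inv_seq f n i : (i <= n)%N -> (fps_inv_seq f n)`_i = fps_inv f i.
Proof.
elim: n => [|n IHn]; first by rewrite leqn0 => /eqP ->.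
rewrite leq_eqVlt => /orP[/eqP -> //|lt_in].
by rewrite /= nth_rcons size_fps_inv_seq lt_in IHn.
Qed.

Lemma fps_invS f n :
  fps_inv f n.+1 =
  - (f 0%N)^-1 * \sum_(i < n.+1) f (n.+1 - i)%N * fps_inv f i.
Proof.
rewrite {1}/fps_inv /= nth_rcons size_fps_inv_seq ltnn eqxx.
by congr (_ * _); apply: eq_bigr => i _; rewrite nth_fps_inv_seq // -ltnS.
Qed.

Lemma fps_mulVf f : f 0%N \is a GRing.unit ->
  fps_mul (fps_inv f) f =1 fps_const 1.
Proof.
move=> Uf [|n]; rewrite /fps_mul /fps_const /=.
  by rewrite big_ord1 mulVr.
rewrite big_ord_recr /= subnn fps_invS mulNr mulNr mulrAC mulVr // mul1r.
by apply/eqP; rewrite subr_eq0; apply/eqP/eq_bigr => i _; rewrite mulrC.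
Qed.

Lemma fps_mulC f g : fps_mul f g =1 fps_mul g f.
Proof.
move=> n; rewrite /fps_mul (reindex_inj rev_ord_inj) /=; apply: eq_bigr => i _.
by rewrite subSS mulrC subKn // -ltnS.
Qed.

Lemma fps_mulfV f : f 0%N \is a GRing.unit ->
  fps_mul f (fps_inv f) =1 fps_const 1.
Proof. by move=> Uf n; rewrite fps_mulC fps_mulVf. Qed.

End FormalPowerSeries.

(* 2 / (1 + (1 - 4t)^(w/2)) * (1 - 4t)^(w x / 2), with x the variable 'X of   *)
(* the coefficient ring {poly rat}.                                           *)
Definition catalan_gf (w : nat) : fps {poly rat} :=
  fps_mul
    (fps_div (fps_const 2%:R)
       (fps_add (fps_const 1) (pow_1m4t ((w%:R / 2%:R : rat)%:P))))
    (pow_1m4t ((w%:R / 2%:R : rat)%:P * 'X)).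

(* C_{n,w}(x) *)
Definition catalan_poly (n w : nat) : {poly rat} := catalan_gf w n.

(* S_{k,d}(m); note that the sum has m + 1 terms. *)
Definition alt_binom_sum (k d m : nat) : rat :=
  \sum_(0 <= i < m.+1) gbinom ((d * i)%:R / 2%:R : rat) k * (-1) ^+ i.

(* The constant term of the denominator of catalan_gf is invertible. *)
Lemma catalan_denom_unit w :
  fps_add (fps_const 1) (pow_1m4t ((w%:R / 2%:R : rat)%:P)) 0%N
    \is a GRing.unit.
Proof.
rewrite /fps_add /fps_const /pow_1m4t /gbinom /= big_ord0 fact0 divr1 mulr1.
by rewrite -polyC1 -polyCD poly_unitE size_polyC coefC.
Qed.

(* Main.v *)
Require Import Defs.
From mathcomp Require Import all_boot all_order all_algebra.
From mathcomp Require Import ring.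

(** Write E(a) = (1 - 4t)^a, so that E(a + b) = E(a) E(b) by Vandermonde's
    identity, and let P = E(w1 w2 x / 2), Q = 1 + E(w1 w2 / 2).  The generating
    function of C_{l,w1}(w2 x) multiplied by 1 + E(w1/2) gives 2 P.  That of
    (-4)^k S_{k,w2}(w1-1) is the alternating geometric sum of the
    E(w2/2)^i, i < w1, which for w1 odd gives Q when multiplied by 1 + E(w2/2).
    Hence both sides of the identity, multiplied by the invertible series
    (1 + E(w1/2)) (1 + E(w2/2)), have generating function 2 P Q. *)

Set Implicit Arguments.
Unset Strict Implicit.

Import GRing.Theory.
Local Open Scope ring_scope.

Section FpsTheory.
Variable R : comUnitRingType.
Implicit Types (f g h : fps R) (a b : R).

Lemma eq_fps_mul f f' g g' :
  f =1 f' -> g =1 g' -> fps_mul f g =1 fps_mul f' g'.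
Proof. by move=> ef eg n; apply: eq_bigr => i _; rewrite ef eg. Qed.

Lemma fps_mul_coef f g n N : (n < N)%N ->
  fps_mul f g n = ((\poly_(i < N) f i) * (\poly_(i < N) g i))`_n.
Proof.
move=> ltnN; rewrite coefM; apply: eq_bigr => i _; rewrite !coef_poly.
by rewrite (leq_ltn_trans (leq_subr _ _) ltnN) (leq_trans (ltn_ord i)).
Qed.

(** Coefficient [n] sees only indices up to [n], so both bracketings equal coefficient [n] of a
    product of three truncated polynomials, where associativity is known. *)
Lemma fps_mulA f g h : fps_mul f (fps_mul g h) =1 fps_mul (fps_mul f g) h.
Proof.
move=> n; pose p (u : fps R) := \poly_(i < n.+1) u i.
transitivity ((p f * p g * p h)`_n); last first.
  rewrite coefM; apply: eq_bigr => i _.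
  by rewrite -fps_mul_coef // coef_poly ltnS leq_subr.
rewrite -mulrA coefM; apply: eq_bigr => i _.
by rewrite -fps_mul_coef ?ltnS ?leq_subr // coef_poly ltn_ord.
Qed.

Lemma fps_mul1 f : fps_mul (fps_const 1) f =1 f.
Proof.
move=> n; rewrite /fps_mul big_ord_recl /fps_const /= mul1r subn0.
by rewrite big1 ?addr0 // => i _; rewrite mul0r.
Qed.

Lemma fps_mulDl f g h :
  fps_mul (fps_add f g) h =1 fps_add (fps_mul f h) (fps_mul g h).
Proof.
by move=> n; rewrite /fps_add -big_split; apply: eq_bigr => i _; rewrite mulrDl.
Qed.

Lemma fps_mulACA f g h k :
  fps_mul (fps_mul f g) (fps_mul h k) =1 fps_mul (fps_mul f h) (fps_mul g k).
Proof.
move=> n; rewrite -2!fps_mulA; apply: eq_fps_mul => // {}n.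
by rewrite !fps_mulA; apply: eq_fps_mul => //; apply: fps_mulC.
Qed.

Lemma fps_mulI f g h : f 0%N \is a GRing.unit ->
  fps_mul f g =1 fps_mul f h -> g =1 h.
Proof.
move=> Uf efgh n; have Vf := fps_mulVf Uf.
have K u : u =1 fps_mul (fps_inv f) (fps_mul f u).
  move=> m; rewrite fps_mulA -[LHS]fps_mul1.
  by apply: eq_fps_mul => // i; rewrite Vf.
by rewrite K [RHS]K; apply: eq_fps_mul.
Qed.

Lemma fps_mul_0 f g : fps_mul f g 0%N = f 0%N * g 0%N.
Proof. by rewrite /fps_mul big_ord1. Qed.

Section GeneralizedBinomial.
(** This makes every [k!] invertible, so that [gbinom] is a true quotient; it is instantiated at
    [rat] and [{poly rat}]. *)
Hypothesis natU : forall k, (k.+1)%:R \is a @GRing.unit R.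

Lemma fact_unit k : (k`!)%:R \is a @GRing.unit R.
Proof. by have := fact_gt0 k; case: (k`!)%N. Qed.

Lemma gbinomS a k : k.+1%:R * gbinom a k.+1 = (a - k%:R) * gbinom a k.
Proof.
rewrite /gbinom big_ord_recr /= factS natrM invrM ?natU ?fact_unit //.
by rewrite [LHS]mulrC !mulrA divrK ?natU // [_ * (a - _)]mulrC.
Qed.

Lemma gbinom0 a : gbinom a 0 = 1.
Proof. by rewrite /gbinom big_ord0 fact0 divr1. Qed.

(** Induction on [n], both sides being multiplied by the unit [n.+1]. Writing n + 1 = i + (n + 1 -
    i) in each term lets [gbinomS] lower one of the two binomials, and (a - i) + (b - (n - i)) = a +
    b - n recombines them. *)
Lemma gbinom_Vandermonde a b n :
  gbinom (a + b) n = \sum_(i < n.+1) gbinom a i * gbinom b (n - i).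
Proof.
elim: n => [|n IHn]; first by rewrite big_ord1 !gbinom0 mulr1.
apply: (mulrI (natU n)); rewrite gbinomS IHn !mulr_sumr.
have split_index (i : 'I_n.+2) : n.+1%:R * (gbinom a i * gbinom b (n.+1 - i)) =
    i%:R * gbinom a i * gbinom b (n.+1 - i) +
    gbinom a i * ((n.+1 - i)%:R * gbinom b (n.+1 - i)).
  have le_in : (i <= n.+1)%N by rewrite -ltnS.
  by rewrite -[in n.+1%:R](subnKC le_in) natrD; ring.
rewrite [RHS](eq_bigr _ (fun i _ => split_index i)) big_split /=.
(* The term i = 0 of the first sum and the term i = n + 1 of the second vanish; after a shift of the
   first, both range over i <= n. *)
rewrite [X in _ = X + _]big_ord_recl /= !mul0r add0r.
rewrite [X in _ = _ + X]big_ord_recr /= subnn mul0r mulr0 addr0 -big_split /=.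
apply: eq_bigr => i _; have le_in : (i <= n)%N by rewrite -ltnS.
rewrite /bump /= add1n subSS gbinomS (subSn le_in) gbinomS natrB //.
by ring.
Qed.

Lemma pow_1m4tD a b :
  pow_1m4t (a + b) =1 fps_mul (pow_1m4t a) (pow_1m4t b).
Proof.
move=> n; rewrite /pow_1m4t gbinom_Vandermonde mulr_suml; apply: eq_bigr => i _.
have le_in : (i <= n)%N by rewrite -ltnS.
by rewrite -[in X in _ * X](subnKC le_in) exprD mulrACA.
Qed.

Lemma pow_1m4t0 : pow_1m4t 0 =1 fps_const (1 : R).
Proof.
case=> [|n]; first by rewrite /pow_1m4t gbinom0 mulr1.
by rewrite /pow_1m4t /gbinom big_ord_recl /= subr0 !mul0r.
Qed.

(** Telescoping: the term of index m contributes (-1)^m (E(am) + E(a(m+1))), whose first half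
    cancels the previous remainder. *)
Lemma alternating_geometric_sum a m :
  fps_mul (fps_add (fps_const 1) (pow_1m4t a))
    (fun k => \sum_(0 <= i < m) (-1) ^+ i * pow_1m4t (a * i%:R) k)
  =1 (fun k => fps_const 1 k - (-1) ^+ m * pow_1m4t (a * m%:R) k).
Proof.
move=> k; elim: m => [|m IHm].
  rewrite mulr0 pow_1m4t0 mul1r subrr /fps_mul big1 // => i _.
  by rewrite big_geq ?mulr0.
rewrite /fps_mul; under eq_bigr do rewrite big_nat_recr //= mulrDr.
rewrite big_split /= [X in X + _]IHm.
under eq_bigr do rewrite mulrCA.
rewrite -mulr_sumr -/(fps_mul _ _ k) fps_mulDl /fps_add fps_mul1 -pow_1m4tD.
have -> : a * m.+1%:R = a + a * m%:R by rewrite -[m.+1]add1n natrD mulrDr mulr1.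
by rewrite exprS; ring.
Qed.

End GeneralizedBinomial.
End FpsTheory.

Section FpsMorphism.
Variables (R S : comUnitRingType) (phi : {rmorphism R -> S}).

Lemma rmorph_fps_mul (f g : fps R) :
  phi \o fps_mul f g =1 fps_mul (phi \o f) (phi \o g).
Proof.
by move=> n; rewrite /= rmorph_sum; apply: eq_bigr => i _; rewrite rmorphM.
Qed.

Lemma rmorph_gbinom (a : R) k : (k`!)%:R \is a @GRing.unit R ->
  phi (gbinom a k) = gbinom (phi a) k.
Proof.
move=> Uk; rewrite /gbinom rmorphM rmorphV // rmorph_nat rmorph_prod.
by congr (_ / _); apply: eq_bigr => i _; rewrite rmorphB rmorph_nat.
Qed.

Lemma rmorph_pow_1m4t (a : R) k : (k`!)%:R \is a @GRing.unit R ->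
  phi (pow_1m4t a k) = pow_1m4t (phi a) k.
Proof.
by move=> Uk; rewrite rmorphM rmorph_gbinom // rmorphXn rmorphN rmorph_nat.
Qed.

End FpsMorphism.

Lemma natS_unit_rat k : k.+1%:R \is a @GRing.unit rat.
Proof. by rewrite unitfE Num.Theory.pnatr_eq0. Qed.

Lemma natS_unit_poly_rat k : k.+1%:R \is a @GRing.unit {poly rat}.
Proof. by rewrite -polyC_natr rmorph_unit ?natS_unit_rat. Qed.

Notation half w := ((w%:R / 2%:R : rat)%:P).
Notation denom w := (fps_add (fps_const 1) (pow_1m4t (half w))).

(** Substituting cx for x is a ring morphism that fixes the constants [half w] and 2, so it only
    rescales the exponent of the numerator. *)
Lemma catalan_gf_comp w (c : nat) :
  fps_mul (denom w) (fun l => catalan_poly l w \Po (c%:R *: 'X)) =1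
  fps_mul (fps_const 2%:R) (pow_1m4t (half (w * c)%N * 'X)).
Proof.
pose phi : {rmorphism {poly rat} -> {poly rat}} := comp_poly (c%:R *: 'X).
have Uk := fact_unit natS_unit_poly_rat.
(* Before substitution: the denominator cancels its inverse. *)
have gfE : fps_mul (denom w) (catalan_gf w) =1
    fps_mul (fps_const 2%:R) (pow_1m4t (half w * 'X)).
  move=> n; rewrite /catalan_gf fps_mulA; apply: eq_fps_mul => // {}n.
  rewrite /fps_div fps_mulA.
  rewrite (eq_fps_mul (fps_mulC _ _) (frefl _)).
  rewrite -fps_mulA (eq_fps_mul (frefl _)
    (fps_mulfV (catalan_denom_unit w))).
  by rewrite fps_mulC fps_mul1.
have phi_const d : phi \o fps_const d%:R =1 fps_const d%:R.
  by case=> [|n] /=; rewrite /fps_const /= ?rmorph_nat ?rmorph0.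
move=> n; transitivity (phi (fps_mul (denom w) (catalan_gf w) n)).
  rewrite [RHS]rmorph_fps_mul; apply: eq_fps_mul => // {}n.
  rewrite /= /fps_add rmorphD rmorph_pow_1m4t //=.
  congr (_ + pow_1m4t _ _); last by rewrite comp_polyC.
  exact/esym/(phi_const 1%N).
rewrite gfE [LHS]rmorph_fps_mul; apply: eq_fps_mul => // {}n.
rewrite /= rmorph_pow_1m4t // rmorphM /= comp_polyC comp_polyX.
congr (pow_1m4t _ _); rewrite -mul_polyC mulrA -polyCM natrM.
by rewrite mulrAC.
Qed.

Lemma alt_binom_sum_gf w m : odd m ->
  fps_mul (denom w)
    (fun k => ((- 4%:R) ^+ k * alt_binom_sum k w (m - 1))%:P) =1
  fps_add (fps_const 1) (pow_1m4t (half (m * w)%N)).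
Proof.
move=> odd_m n; have m_gt0 := odd_gt0 odd_m.
transitivity (fps_const 1 n - (-1) ^+ m * pow_1m4t (half w * m%:R) n).
  rewrite -alternating_geometric_sum; last exact: natS_unit_poly_rat.
  (* [alt_binom_sum k w (m - 1)] has exactly m terms because m > 0. *)
  apply: eq_fps_mul => // k; rewrite /alt_binom_sum subn1 prednK //.
  rewrite mulr_sumr rmorph_sum; apply: eq_bigr => i _.
  rewrite -polyC_natr -polyCM -(rmorph_pow_1m4t (@polyC rat)); last first.
    by apply: (fact_unit natS_unit_rat).
  have -> : (-1) ^+ i = ((-1) ^+ i : rat)%:P by rewrite polyC_exp polyCN.
  rewrite -polyCM; congr _%:P; rewrite /pow_1m4t natrM [_ * i%:R / _]mulrAC.
  by rewrite [LHS]mulrC [RHS]mulrA [(-1) ^+ i * _]mulrC.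
(* Oddness of m turns the remainder -(-1)^m E(wm/2) into +E(wm/2). *)
rewrite -signr_odd odd_m expr1 mulN1r opprK /fps_add.
by rewrite -polyC_natr -polyCM mulrAC -natrM mulnC.
Qed.

Theorem theorem2 (n w1 w2 : nat)
    (hw1 : (w1 = 1 %[mod 2])%N) (hw2 : (w2 = 1 %[mod 2])%N) :
  \sum_(0 <= l < n.+1)
     ((- 4%:R) ^+ (n - l) * alt_binom_sum (n - l) w2 (w1 - 1) : rat) *:
       (catalan_poly l w1 \Po (w2%:R *: 'X)) =
  \sum_(0 <= l < n.+1)
     ((- 4%:R) ^+ (n - l) * alt_binom_sum (n - l) w1 (w2 - 1) : rat) *:
       (catalan_poly l w2 \Po (w1%:R *: 'X)).
Proof.
have oddP w : (w = 1 %[mod 2])%N -> odd w by rewrite !modn2; case: odd.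
pose F w c : fps {poly rat} := fun l => catalan_poly l w \Po (c%:R *: 'X).
pose T d m : fps {poly rat} :=
  fun k => ((- 4%:R) ^+ k * alt_binom_sum k d (m - 1))%:P.
have sumE u v : \sum_(0 <= l < n.+1)
     ((- 4%:R) ^+ (n - l) * alt_binom_sum (n - l) v (u - 1) : rat) *:
       (catalan_poly l u \Po (v%:R *: 'X)) = fps_mul (F u v) (T v u) n.
  by rewrite big_mkord; apply: eq_bigr => i _; rewrite [RHS]mulrC mul_polyC.
(* The right-hand side depends on [u] and [v] only through [u * v], which is the symmetry sought. *)
have prodE u v : odd u -> fps_mul (fps_mul (denom u) (denom v))
    (fps_mul (F u v) (T v u)) =1
    fps_mul (fps_mul (fps_const 2%:R) (pow_1m4t (half (u * v)%N * 'X)))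
      (fps_add (fps_const 1) (pow_1m4t (half (u * v)%N))).
  move=> odd_u k; rewrite fps_mulACA; apply: eq_fps_mul => {}k.
    exact: catalan_gf_comp.
  exact: alt_binom_sum_gf.
rewrite !sumE; apply: (@fps_mulI _ (fps_mul (denom w1) (denom w2))).
  by rewrite fps_mul_0 unitrM !catalan_denom_unit.
(* Swapping the two denominators on the right makes [prodE] apply with [w1] and [w2] exchanged. *)
move=> k; rewrite prodE ?oddP // [RHS](eq_fps_mul (fps_mulC _ _) (frefl _)).
by rewrite prodE ?oddP // [(w2 * w1)%N]mulnC.
Qed.
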